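(* Let $\gamma:[a,b]\to\mathbb K\setminus\{0\}$ be a path with companion $\mathfrak I^\gamma:[a,b]\to\mathbb S/\{\pm\mathrm{Id}\}$. For every $k\in\mathbb Z$, let $\Gamma_k=(\gamma,\operatorname{Arg}^\gamma_{2k})$ be a $\mathfrak I^\gamma$-lift of $\gamma$ to $\mathcal E_{\mathbb K}^+$ with $\arg^\gamma_{2k}(a)\in[2k\pi,(2k+1)\pi]$. Then the map defined on the interval $[a,b]$ by $$(\log_k\circ\gamma)(t):=(L\circ\Gamma_k)(t)=\log|\gamma(t)|+\operatorname{Arg}^\gamma_{2k}(t)$$ is a continuation of the hypercomplex logarithm along $\gamma$ with initial point $\log|\gamma(a)|+\operatorname{Arg}^\gamma_{2k}(a)$.
   Context: $\mathbb K$ denotes either the algebra of quaternions or the algebra of octonions, $\operatorname{Im}(\mathbb K)$ its space of purely imaginary elements, $\mathbb S=\{I\in\mathbb K: I^2=-1\}$ and $\mathbb C_I=\mathbb R+\mathbb RI$. A path is a continuous map from a compact interval. $\exp(q)=\sum_{k\ge 0}q^k/k!$. The logarithm manifold is $\mathcal E_{\mathbb K}^+=\{(r\exp p,p): r>0,\ p\in\operatorname{Im}(\mathbb K)\}\subset\mathbb K\times\operatorname{Im}(\mathbb K)$ and $L:\mathcal E_{\mathbb K}^+\to\mathbb K$, $L(q,p)=\log|q|+p$. A lift of $\gamma$ is a path in $\mathcal E_{\mathbb K}^+$ whose first component is $\gamma$. A continuation of the logarithm along $\gamma$ is a path $\widetilde\gamma:[a,b]\to\mathbb K$ with $\exp\circ\widetilde\gamma=\gamma$;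 its initial point is $\widetilde\gamma(a)$. A companion of the path $\gamma$ is a path $\mathfrak I^\gamma:[a,b]\to\mathbb S/\{\pm\mathrm{Id}\}$ (antipodal quotient) such that $\gamma(t)\in\mathbb C_{\mathfrak I^\gamma(t)}$ for every $t$, where $\mathbb C_{[J]}=\mathbb C_J=\mathbb C_{-J}$. A $\mathfrak I^\gamma$-lift $\Gamma_k=(\gamma,\operatorname{Arg}^\gamma_{2k})$ is a lift of $\gamma$ to $\mathcal E_{\mathbb K}^+$ of the form $\operatorname{Arg}^\gamma_{2k}=\mathcal I^\gamma\arg^\gamma_{2k}$, where $\mathcal I^\gamma:[a,b]\to\mathbb S$ is a continuous lift of $\mathfrak I^\gamma$ (i.e. $[\mathcal I^\gamma(t)]=\mathfrak I^\gamma(t)$) and $\arg^\gamma_{2k}=\arg^\gamma+2k\pi$ with $\arg^\gamma:[a,b]\to\mathbb R$ continuous, $\arg^\gamma(a)\in[0,\pi]$, and $(\gamma,\mathcal I^\gamma\arg^\gamma)$ a lift of $\gamma$. Such lifts exist for every path with companion. *)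

(* Defs.v *)
From HB Require Import structures.
From mathcomp Require Import all_boot all_order all_algebra.
From mathcomp Require Import all_classical all_reals all_analysis.
Import Order.TTheory GRing.Theory Num.Theory numFieldNormedType.Exports.

Set Implicit Arguments.
Unset Strict Implicit.
Unset Printing Implicit Defensive.

Local Open Scope classical_set_scope.
Local Open Scope quotient_scope.
Local Open Scope ring_scope.

(* The Cayley-Dickson process: R ~> C ~> H ~> O.  The library norm on iterated
   products is the max norm; it only serves to provide the topology.  The
   Euclidean modulus is [modulus] below. *)
Record cdAlgebra (R : realType) := CDAlgebra {
  cd_sort :> normedModType R;
  cd_one : cd_sort;
  cd_mul : cd_sort -> cd_sort -> cd_sort;
  cd_conj : cd_sort -> cd_sort;
  cd_re : cd_sort -> R
}.

Definition cd_base (R : realType) : cdAlgebra R :=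
  @CDAlgebra R R^o 1 (fun x y => x * y) id id.

(* (a, b) (c, d) = (a c - d^* b, d a + b c^* ) *)
Definition cd_double (R : realType) (A : cdAlgebra R) : cdAlgebra R :=
  @CDAlgebra R (A * A)%type (cd_one A, 0)
    (fun x y => (cd_mul x.1 y.1 - cd_mul (cd_conj y.2) x.2,
                 cd_mul y.2 x.1 + cd_mul x.2 (cd_conj y.1)))
    (fun x => (cd_conj x.1, - x.2))
    (fun x => cd_re x.1).

Inductive hypercomplex_kind := Quaternions | Octonions.

Definition hypercomplex (R : realType) (kind : hypercomplex_kind) :
    cdAlgebra R :=
  match kind with
  | Quaternions => cd_double (cd_double (cd_base R))
  | Octonions => cd_double (cd_double (cd_double (cd_base R)))
  end.

Section Hypercomplex.
Context {R : realType} (K : cdAlgebra R).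
Implicit Types (p q : K) (r : R) (a b : R).

Definition of_real r : K := r *: cd_one K.

Definition modulus q : R := Num.sqrt (cd_re (cd_mul q (cd_conj q))).

Definition cd_pow q (n : nat) : K := iter n (cd_mul q) (cd_one K).

Definition hexp q : K :=
  lim (series (fun n : nat => (n`!%:R^-1 : R) *: cd_pow q n) @ \oo).

Definition imaginary : set K := [set p | cd_re p = 0].

Definition imaginary_units : set K := [set I | cd_mul I I = - cd_one K].

Definition complex_line (I : K) : set K :=
  [set x | exists u v : R, x = of_real u + v *: I].

Definition antipodal_rel : rel imaginary_units :=
  fun I J => (set_val I == set_val J) || (set_val I == - set_val J).

Lemma antipodal_rel_refl : reflexive antipodal_rel.
Proof. by move=> I; rewrite /antipodal_rel eqxx. Qed.

Lemma antipodal_rel_sym : symmetric antipodal_rel.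
Proof.
by move=> I J; rewrite /antipodal_rel eq_sym [X in _ || X]eq_sym eqr_oppLR.
Qed.

Lemma antipodal_rel_trans : transitive antipodal_rel.
Proof.
move=> J I H; rewrite /antipodal_rel.
move=> /orP[]/eqP-> /orP[]/eqP->; rewrite ?opprK eqxx ?orbT //.
Qed.

Canonical antipodal_equiv := EquivRel antipodal_rel
  antipodal_rel_refl antipodal_rel_sym antipodal_rel_trans.

(* S / {Id, -Id}, where S is [imaginary_units] with its subspace topology *)
Definition antipodal_sphere := quotient_topology {eq_quot antipodal_equiv}.

Definition antipodal_class (I : imaginary_units) : antipodal_sphere :=
  \pi_antipodal_sphere I.

(* C_[J], computed on a representative; see [class_lineE] *)
Definition class_line (c : antipodal_sphere) : set K :=
  complex_line (set_val (repr c)).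

Lemma class_lineE (J : imaginary_units) :
  class_line (antipodal_class J) = complex_line (set_val J).
Proof.
have : antipodal_rel (repr (antipodal_class J)) J.
  by apply/(@eqquotP _ antipodal_equiv {eq_quot antipodal_equiv}); exact: reprK.
rewrite /class_line; move: (repr _) => I /orP[]/eqP -> //.
apply/seteqP; split=> x [u [v ->]]; exists u, (- v).
  by rewrite scalerN scaleNr.
by rewrite scalerN scaleNr opprK.
Qed.

Definition is_path (T : topologicalType) a b (f : R -> T) : Prop :=
  {within `[a, b], continuous f}.

Definition log_manifold : set (K * K) :=
  [set x | exists r p, [/\ 0 < r, imaginary p & x = (r *: hexp p, p)]].

(* L; only its values on [log_manifold] matter *)
Definition log_chart (x : K * K) : K := of_real (ln (modulus x.1)) + x.2.

Definition is_lift a b (gamma : R -> K) (Gamma : R -> K * K) : Prop :=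
  is_path a b Gamma /\
  forall t, t \in `[a, b] -> log_manifold (Gamma t) /\ (Gamma t).1 = gamma t.

Definition is_log_continuation a b (gamma tgamma : R -> K) : Prop :=
  is_path a b tgamma /\ forall t, t \in `[a, b] -> hexp (tgamma t) = gamma t.

Definition is_companion a b (gamma : R -> K) (c : R -> antipodal_sphere) :
    Prop :=
  is_path a b c /\ forall t, t \in `[a, b] -> class_line (c t) (gamma t).

Definition arg_branch (k : int) (arg : R -> R) (t : R) : R :=
  arg t + 2 * k%:~R * pi.

Definition is_companion_lift a b (gamma : R -> K) (c : R -> antipodal_sphere)
    (k : int) (cI : R -> imaginary_units) (arg : R -> R) (Gamma : R -> K * K) : Prop :=
  [/\ is_path a b cI /\
        (forall t, t \in `[a, b] -> antipodal_class (cI t) = c t),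
      is_path a b arg /\ 0 <= arg a <= pi,
      is_lift a b gamma (fun t => (gamma t, arg t *: set_val (cI t))),
      is_lift a b gamma Gamma &
      forall t, t \in `[a, b] ->
        Gamma t = (gamma t, arg_branch k arg t *: set_val (cI t))].

End Hypercomplex.

Arguments of_real {R} K r.
Arguments imaginary {R} K _.
Arguments imaginary_units {R} K _.

(* Main.v *)
(* A point (gamma, p) of the logarithm manifold has gamma = r exp p with r > 0
   and p imaginary.  On the lift p = t I with I a unit, so everything happens in
   the complex line spanned by 1 and I: there exp (s + t I) = e^s (cos t + sin t I),
   hence |exp p| = 1, |gamma| = r and exp (log |gamma| + p) = gamma.
   Euler's formula comes from the linear differential system satisfied by the
   real and imaginary parts of the sum over n of (s + t i)^n x^n / n!. *)
Require Import Defs.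
From HB Require Import structures.
From mathcomp Require Import all_boot all_order all_algebra.
From mathcomp Require Import all_classical all_reals all_analysis.
From mathcomp Require Import ring lra.
Import Order.TTheory GRing.Theory Num.Theory numFieldNormedType.Exports.

Set Implicit Arguments.
Unset Strict Implicit.
Unset Printing Implicit Defensive.

Local Open Scope classical_set_scope.
Local Open Scope ring_scope.

(** * Algebraic laws preserved by Cayley-Dickson doubling *)

Record cd_laws (R : realType) (A : cdAlgebra R) : Prop := CDLaws {
  cd_mulDl : forall x y z : A, cd_mul (x + y) z = cd_mul x z + cd_mul y z;
  cd_mulDr : forall x y z : A, cd_mul z (x + y) = cd_mul z x + cd_mul z y;
  cd_mulZl : forall (r : R) (x y : A), cd_mul (r *: x) y = r *: cd_mul x y;
  cd_mulZr : forall (r : R) (x y : A), cd_mul x (r *: y) = r *: cd_mul x y;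
  cd_mul1l : forall x : A, cd_mul (cd_one A) x = x;
  cd_mul1r : forall x : A, cd_mul x (cd_one A) = x;
  cd_reD : forall x y : A, cd_re (x + y) = cd_re x + cd_re y;
  cd_reZ : forall (r : R) (x : A), cd_re (r *: x) = r * cd_re x;
  cd_re1 : cd_re (cd_one A) = 1;
  cd_conjE : forall x : A, cd_conj x = (2 * cd_re x) *: cd_one A - x;
  cd_sqnorm_continuous : continuous (fun x : A => cd_re (cd_mul x (cd_conj x)))
}.

Lemma cd_laws_base (R : realType) : cd_laws (cd_base R).
Proof.
split=> /=.
- by move=> x y z; rewrite mulrDl.
- by move=> x y z; rewrite mulrDr.
- by move=> r x y; rewrite /GRing.scale /= mulrA.
- by move=> r x y; rewrite /GRing.scale /= mulrCA.
- exact: mul1r.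
- exact: mulr1.
- by [].
- by [].
- by [].
- by move=> x; rewrite /GRing.scale /= mulr1 mulr_natl mulr2n addrK.
- by move=> x; apply: cvgM.
Qed.

Section CDLawsTheory.
Variables (R : realType) (A : cdAlgebra R) (L : cd_laws A).
Implicit Types (x y z : A) (r : R).

Lemma cd_mul0l x : cd_mul 0 x = 0.
Proof. by rewrite -[0 in LHS](scale0r x) (cd_mulZl L) scale0r. Qed.

Lemma cd_mul0r x : cd_mul x 0 = 0.
Proof. by rewrite -[0 in LHS](scale0r x) (cd_mulZr L) scale0r. Qed.

Lemma cd_mulNl x y : cd_mul (- x) y = - cd_mul x y.
Proof. by rewrite -scaleN1r (cd_mulZl L) scaleN1r. Qed.

Lemma cd_mulNr x y : cd_mul x (- y) = - cd_mul x y.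
Proof. by rewrite -scaleN1r (cd_mulZr L) scaleN1r. Qed.

Lemma cd_conjD x y : cd_conj (x + y) = cd_conj x + cd_conj y.
Proof.
by rewrite !(cd_conjE L) (cd_reD L) mulrDr scalerDl opprD addrACA.
Qed.

Lemma cd_conjZ r x : cd_conj (r *: x) = r *: cd_conj x.
Proof.
by rewrite !(cd_conjE L) (cd_reZ L) scalerBr scalerA mulrCA.
Qed.

Lemma cd_conj0 : cd_conj (0 : A) = 0.
Proof. by rewrite -[0 in LHS](scale0r (cd_one A)) cd_conjZ scale0r. Qed.

Lemma cd_conj1 : cd_conj (cd_one A) = cd_one A.
Proof.
by rewrite (cd_conjE L) (cd_re1 L) mulr1 scaler_nat mulr2n addrK.
Qed.

Lemma cd_conjN x : cd_conj (- x) = - cd_conj x.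
Proof. by rewrite -scaleN1r cd_conjZ scaleN1r. Qed.

(** The conjugate is a real combination of [1] and [x], and both commute with [x]. *)
Lemma cd_mul_conjC x : cd_mul (cd_conj x) x = cd_mul x (cd_conj x).
Proof.
rewrite (cd_conjE L) (cd_mulDl L) (cd_mulDr L) (cd_mulZl L) (cd_mulZr L).
by rewrite (cd_mul1l L) (cd_mul1r L) cd_mulNl cd_mulNr.
Qed.

(** Associativity and commutativity, which doubling destroys, are not among the laws; those listed
    are inherited componentwise, so they reach the octonions. *)
Lemma cd_laws_double : cd_laws (cd_double A).
Proof.
split=> /=.
- move=> x y z; apply: injective_projections => /=.
    by rewrite (cd_mulDl L) (cd_mulDr L) opprD addrACA.
  by rewrite (cd_mulDl L) (cd_mulDr L) addrACA.
- move=> x y z; apply: injective_projections => /=.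
    by rewrite cd_conjD (cd_mulDl L) (cd_mulDr L) opprD addrACA.
  by rewrite cd_conjD (cd_mulDl L) (cd_mulDr L) addrACA.
- move=> r x y; apply: injective_projections => /=.
    by rewrite (cd_mulZl L) (cd_mulZr L) -scalerBr.
  by rewrite (cd_mulZl L) (cd_mulZr L) -scalerDr.
- move=> r x y; apply: injective_projections => /=.
    by rewrite cd_conjZ (cd_mulZl L) (cd_mulZr L) -scalerBr.
  by rewrite cd_conjZ (cd_mulZl L) (cd_mulZr L) -scalerDr.
- case=> x1 x2 /=; apply: injective_projections => /=.
    by rewrite (cd_mul1l L) cd_mul0r subr0.
  by rewrite (cd_mul1r L) cd_mul0l addr0.
- case=> x1 x2 /=; apply: injective_projections => /=.
    by rewrite cd_conj0 (cd_mul1r L) cd_mul0l subr0.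
  by rewrite cd_conj1 (cd_mul1r L) cd_mul0l add0r.
- by move=> x y; exact: cd_reD.
- by move=> r x; exact: cd_reZ.
- exact: cd_re1.
- case=> x1 x2 /=; congr pair => /=; first exact: cd_conjE.
  by rewrite scaler0 sub0r.
(* The squared norm of a pair is the sum of the squared norms of its components. *)
- pose N (y : A) := cd_re (cd_mul y (cd_conj y)).
  rewrite [F in continuous F](_ : _ = fun x : cd_double A => N x.1 + N x.2).
    move=> x; apply: cvgD.
      by apply: (@continuous_comp _ _ _ fst N); [exact: cvg_fst|
        exact: cd_sqnorm_continuous].
    by apply: (@continuous_comp _ _ _ snd N); [exact: cvg_snd|
      exact: cd_sqnorm_continuous].
  apply/funext => x.
  by rewrite cd_conjN cd_mulNl opprK cd_mul_conjC (cd_reD L).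
Qed.

(** Conjugation sends [u + v I] to [u - v I], and [I I = -1]. The real part is constrained on
    [v *: I], the form in which [imaginary] supplies it on a lift. *)
Lemma cd_sqnorm_unit_line u v (I : A) : imaginary_units A I ->
  cd_re (v *: I) = 0 ->
  let q := of_real A u + v *: I in
  cd_re (cd_mul q (cd_conj q)) = u ^+ 2 + v ^+ 2.
Proof.
move=> /= II reI.
have reN x : cd_re (- x) = - cd_re x.
  by rewrite -scaleN1r (cd_reZ L) mulN1r.
rewrite /of_real cd_conjD !cd_conjZ cd_conj1.
rewrite -cd_conjZ (cd_conjE L (v *: I)) reI mulr0 scale0r sub0r.
rewrite (cd_mulDr L) !(cd_mulDl L) !cd_mulNr !(cd_mulZl L) !(cd_mulZr L).
rewrite !(cd_mul1l L) (cd_mul1r L) II !scalerN opprK !scalerA.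
rewrite !(cd_reD L) reN !(cd_reZ L) (cd_re1 L) -!mulrA.
rewrite (mulrCA v u) -(cd_reZ L v) reI !mulr0.
ring.
Qed.

End CDLawsTheory.

Lemma cd_laws_hypercomplex (R : realType) kind : cd_laws (hypercomplex R kind).
Proof.
by case: kind; do !apply: cd_laws_double; exact: cd_laws_base.
Qed.

(** * Real exponential generating series and Euler's formula *)

Section ExponentialSeries.
Variable R : realType.
Implicit Types (c d : R^nat) (C M p q x : R).

Definition exp_series c x : R := limn (pseries (fun n => c n / n`!%:R) x).

(** Absolute convergence by comparison with [C] times the series of [exp(|M| |x|)]. *)
Lemma is_cvg_exp_series c C M x : (forall n, `|c n| <= C * M ^+ n) ->
  cvgn (pseries (fun n => c n / n`!%:R) x).
Proof.
move=> cM.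
have cvgM : cvgn (series (C *: exp_coeff (`|M| * `|x|))).
  exact/is_cvg_seriesZ/is_cvg_series_exp_coeff.
have C0 : 0 <= C.
  by have := cM 0%N; rewrite expr0 mulr1; apply: le_trans.
have cM' n : `|c n| <= C * `|M| ^+ n.
  by apply: le_trans (cM n) _; rewrite ler_wpM2l// -normrX ler_norm.
apply: normed_cvg; apply: series_le_cvg cvgM => n.
- exact: normr_ge0.
- by rewrite fctE /exp_coeff /= mulr_ge0// divr_ge0// exprn_ge0// mulr_ge0.
- rewrite fctE /exp_coeff /= !normrM normfV normr_nat normrX exprMn.
  rewrite /GRing.scale /= !mulrA mulrAC ler_wpM2r// ler_wpM2r//.
Qed.

(** Termwise differentiation cancels [n+1] against [(n+1)!], leaving a shift of the coefficients;
    the shift keeps a geometric bound, with constant [C * M]. *)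
Lemma is_derive_exp_series c C M x : (forall n, `|c n| <= C * M ^+ n) ->
  is_derive x 1 (exp_series c) (exp_series (fun n => c n.+1) x).
Proof.
move=> cM.
have shiftM (d : R^nat) D : (forall n, `|d n| <= D * M ^+ n) ->
    forall n, `|d n.+1| <= D * M * M ^+ n.
  by move=> dM n; rewrite -mulrA -exprS.
have diffs (d : R^nat) : pseries_diffs (fun n => d n / n`!%:R) =
    (fun n => d n.+1 / n`!%:R).
  apply/funext => n; rewrite /pseries_diffs factS natrM; field.
  by rewrite nat1r !pnatr_eq0 -lt0n fact_gt0.
rewrite /exp_series -diffs.
(* The series and its first two formal derivatives must converge at a point beyond [|x|]. *)
apply: (@pseries_snd_diffs _ _ (`|x| + 1)).
- exact: is_cvg_exp_series cM.
- by rewrite diffs; apply: is_cvg_exp_series (shiftM _ _ cM).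
- rewrite diffs (diffs (fun n => c n.+1)).
  exact: is_cvg_exp_series (shiftM _ _ (shiftM _ _ cM)).
- by rewrite [ltRHS]ger0_norm// ltrDl.
Qed.

Lemma exp_seriesD c d C M p q x :
  (forall n, `|c n| <= C * M ^+ n) -> (forall n, `|d n| <= C * M ^+ n) ->
  exp_series (fun n => p * c n + q * d n) x =
  p * exp_series c x + q * exp_series d x.
Proof.
move=> cM dM; apply/cvg_lim => //.
rewrite (_ : pseries _ x = fun n => p * pseries (fun n => c n / n`!%:R) x n +
                                   q * pseries (fun n => d n / n`!%:R) x n).
  by apply: cvgD; apply: cvgMl_tmp; [exact: is_cvg_exp_series cM|
                                 exact: is_cvg_exp_series dM].
apply/funext => n; rewrite /pseries /series /= !mulr_sumr -big_split /=.
by apply: eq_bigr => i _; rewrite !mulrDl !mulrA.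
Qed.

Lemma exp_series0 c : exp_series c 0 = c 0%N.
Proof.
(* The partial sum of index 0 is empty; from index 1 on it is constantly [c 0]. *)
apply/cvg_lim => //; rewrite -cvg_shiftS /=.
rewrite (_ : (fun _ => _) = cst (c 0%N)); first exact: cvg_cst.
apply/funext => n; rewrite /pseries /series /= big_nat_recl//= big1.
  by rewrite expr0 fact0 divr1 mulr1 addr0.
by move=> i _; rewrite exprS mul0r mulr0.
Qed.

Variables s t : R.

(* [(Re, Im)] of [(s + t i) ^+ n] *)
Definition complex_pow (n : nat) : R * R :=
  iter n (fun z => (s * z.1 - t * z.2, s * z.2 + t * z.1)) (1, 0).

Local Notation re := (fun n => (complex_pow n).1).
Local Notation im := (fun n => (complex_pow n).2).

(** The sum of the absolute values of the two parts is submultiplicative under complex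
    multiplication. *)
Lemma complex_pow_le n :
  `|(complex_pow n).1| + `|(complex_pow n).2| <= (`|s| + `|t|) ^+ n.
Proof.
elim: n => [|n IH]; first by rewrite /= normr1 normr0 addr0 expr0.
rewrite exprS /=; move: (complex_pow n).1 (complex_pow n).2 IH => u v IH.
apply: le_trans (ler_wpM2l _ IH); last by rewrite addr_ge0.
have := ler_normB (s * u) (t * v); have := ler_normD (s * v) (t * u).
rewrite !normrM; nra.
Qed.

Lemma re_complex_pow_le n : `|(complex_pow n).1| <= 1 * (`|s| + `|t|) ^+ n.
Proof.
by rewrite mul1r; apply: le_trans (complex_pow_le n); rewrite lerDl.
Qed.

Lemma im_complex_pow_le n : `|(complex_pow n).2| <= 1 * (`|s| + `|t|) ^+ n.
Proof.
by rewrite mul1r; apply: le_trans (complex_pow_le n); rewrite lerDr.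
Qed.

(** Shifting [complex_pow] multiplies it by [s + t i], so the series solves [F' = (s + t i) F]. As
    an instance, this lets [is_derive_eq] differentiate compound expressions. *)
#[local] Instance is_derive_re x :
  is_derive x 1 (exp_series re) (s * exp_series re x - t * exp_series im x).
Proof.
rewrite (_ : _ - _ = exp_series (fun n => (complex_pow n.+1).1) x).
  exact: (is_derive_exp_series (c := re) x re_complex_pow_le).
rewrite -mulNr -(exp_seriesD _ _ _ re_complex_pow_le im_complex_pow_le).
by congr (exp_series _ x); apply/funext => n; rewrite mulNr.
Qed.

#[local] Instance is_derive_im x :
  is_derive x 1 (exp_series im) (s * exp_series im x + t * exp_series re x).
Proof.
rewrite -(exp_seriesD _ _ _ im_complex_pow_le re_complex_pow_le).
exact: (is_derive_exp_series (c := im) x im_complex_pow_le).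
Qed.

#[local] Instance is_derive_cos_scale x :
  is_derive x 1 (fun y => cos (t * y)) (- t * sin (t * x)).
Proof.
apply: is_derive_eq; rewrite /GRing.scale /=; ring.
Qed.

#[local] Instance is_derive_sin_scale x :
  is_derive x 1 (fun y => sin (t * y)) (t * cos (t * x)).
Proof.
apply: is_derive_eq; rewrite /GRing.scale /=; ring.
Qed.

#[local] Instance is_derive_expR_scale x :
  is_derive x 1 (fun y => expR (- s * y)) (- s * expR (- s * x)).
Proof.
apply: is_derive_eq; rewrite /GRing.scale /=; ring.
Qed.

(* The two functions below are the real and imaginary parts of
   [exp_series (complex_pow) y * exp (- (s + t i) y)]. *)
Let re_quotient y :
  expR (- s * y) *
  (exp_series re y * cos (t * y) + exp_series im y * sin (t * y)) = 1.
Proof.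
(* [f] is the left-hand side as a function of [y]; its derivative vanishes, so it equals its value
   at 0. *)
set v := LHS; pattern y in v; move: @v; set f := (X in let _ := X y in _) => /=.
apply: (@eq_trans _ _ (f 0)); last first.
  by rewrite /f !mulr0 expR0 cos0 sin0 !exp_series0 /=; ring.
apply: is_derive_0_is_cst => {}x.
rewrite /f; apply: is_derive_eq; rewrite /GRing.scale /=; ring.
Qed.

Let im_quotient y :
  expR (- s * y) *
  (exp_series im y * cos (t * y) - exp_series re y * sin (t * y)) = 0.
Proof.
set v := LHS; pattern y in v; move: @v; set f := (X in let _ := X y in _) => /=.
apply: (@eq_trans _ _ (f 0)); last first.
  by rewrite /f !mulr0 expR0 cos0 sin0 !exp_series0 /=; ring.
apply: is_derive_0_is_cst => {}x.
rewrite /f; apply: is_derive_eq; rewrite /GRing.scale /=; ring.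
Qed.

(** By the two quotient identities, the pair of sums rotated by [-t] is [(e^s, 0)]; rotating back
    uses [cos^2 + sin^2 = 1]. *)
Lemma exp_series_complex_pow :
  exp_series re 1 = expR s * cos t /\ exp_series im 1 = expR s * sin t.
Proof.
have := re_quotient 1; have := im_quotient 1; rewrite !mulr1 expRN.
have e0 : expR s != 0 by rewrite expR_eq0.
move=> /eqP; rewrite mulf_eq0 invr_eq0 (negbTE e0) /= => /eqP im0.
move=> /(congr1 ( *%R (expR s))); rewrite mulVKf// mulr1 => re1.
have cs := cos2Dsin2 t.
move: (exp_series re 1) (exp_series im 1) (expR s) (cos t) (sin t)
  {e0} im0 re1 cs => u v e c d uv1 uv2 cs; split.
  by rewrite -[RHS]subr0 -(mulr0 d) -uv1 -uv2 -[LHS]mulr1 -cs; ring.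
by rewrite -[RHS]addr0 -(mulr0 c) -uv1 -uv2 -[LHS]mulr1 -cs; ring.
Qed.

End ExponentialSeries.

(** * Exponential and modulus on the complex line of a unit *)

Section HypercomplexExponential.
Variables (R : realType) (A : cdAlgebra R) (L : cd_laws A).
Variables (I : A) (II : imaginary_units A I).

(** Both powers multiply by the base on the left, one factor at a time, so each step follows from
    bilinearity and [I I = -1]. *)
Lemma cd_pow_complex_line s t n :
  cd_pow (of_real A s + t *: I) n =
  of_real A (complex_pow s t n).1 + (complex_pow s t n).2 *: I.
Proof.
elim: n => [|n IH]; first by rewrite /of_real scale1r scale0r addr0.
rewrite /cd_pow iterS -/(cd_pow _ n) IH /= /of_real.
move: (complex_pow s t n) => [u v] /=.
rewrite (cd_mulDr L) !(cd_mulDl L) !(cd_mulZl L) !(cd_mulZr L).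
rewrite !(cd_mul1l L) (cd_mul1r L) II !scalerN !scalerA.
rewrite scalerBl scalerDl [RHS]addrACA -!addrA; congr (_ + _).
by rewrite addrC -addrA.
Qed.

(** Each partial sum splits into real partial sums at [x = 1] times [1] and [I], so the limit is
    taken in the coefficients. *)
Lemma hexp_complex_line s t :
  hexp (of_real A s + t *: I) =
  of_real A (expR s * cos t) + (expR s * sin t) *: I.
Proof.
have [<- <-] := exp_series_complex_pow s t.
apply/cvg_lim; first exact: norm_hausdorff.
rewrite (_ : series _ = fun n =>
    pseries (fun m => (complex_pow s t m).1 / m`!%:R) 1 n *: cd_one A +
    pseries (fun m => (complex_pow s t m).2 / m`!%:R) 1 n *: I).
  apply: cvgD; apply: cvgZr_tmp.
    exact: is_cvg_exp_series (re_complex_pow_le s t).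
  exact: is_cvg_exp_series (im_complex_pow_le s t).
apply/funext => n; rewrite /pseries /series /= !scaler_suml -big_split /=.
apply: eq_bigr => i _; rewrite cd_pow_complex_line expr1n !mulr1.
by rewrite /of_real scalerDr !scalerA ![_^-1 * _]mulrC.
Qed.

Lemma modulus_complex_line_polar r t : 0 <= r -> imaginary A (t *: I) ->
  modulus (r *: hexp (t *: I)) = r.
Proof.
rewrite /imaginary /= => r0 reI.
rewrite -[t *: I]add0r -(scale0r (cd_one A)) -/(of_real A 0).
rewrite hexp_complex_line expR0 !mul1r scalerDr /of_real !scalerA.
rewrite /modulus (cd_sqnorm_unit_line L) //.
  rewrite !exprMn -mulrDr cos2Dsin2 mulr1 sqrtr_sqr ger0_norm//.
(* The real part of [(r sin t) I] must vanish: either [sin t = 0], or dividing by [t] shows that [I]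
   has real part 0. *)
have [->|t0] := eqVneq t 0.
  by rewrite sin0 mulr0 scale0r -(scale0r I) (cd_reZ L) mul0r.
move: reI; rewrite !(cd_reZ L) => /eqP.
by rewrite mulf_eq0 (negbTE t0) /= => /eqP ->; rewrite mulr0.
Qed.

(** Adding the real number [ln r] to [t I] stays on the same line and multiplies the exponential by
    [r]. *)
Lemma hexp_log_chart r t : 0 < r -> imaginary A (t *: I) ->
  hexp (log_chart (r *: hexp (t *: I), t *: I)) = r *: hexp (t *: I).
Proof.
move=> r0 imI; rewrite /log_chart /= modulus_complex_line_polar// ?ltW//.
rewrite hexp_complex_line lnK ?posrE//.
rewrite -[in RHS](add0r (t *: I)) -(scale0r (cd_one A)) -/(of_real A 0).
by rewrite hexp_complex_line expR0 !mul1r scalerDr /of_real !scalerA.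
Qed.

End HypercomplexExponential.

(** * Continuity of the chart and continuation along the lift *)

Lemma log_chart_continuous (R : realType) (A : cdAlgebra R) (L : cd_laws A)
    (x : A * A) : 0 < modulus x.1 ->
  {for x, continuous (@log_chart R A)}.
Proof.
move=> x0; apply: cvgD; last exact: cvg_snd.
apply: cvgZr_tmp.
apply: (@continuous_comp _ _ _ (fun y : A * A => modulus y.1) (@ln R));
  last exact: continuous_ln.
apply: (@continuous_comp _ _ _ fst (@modulus R A)); first exact: cvg_fst.
apply: (@continuous_comp _ _ _ (fun y : A => cd_re (cd_mul y (cd_conj y)))
  (@Num.sqrt R)).
  exact: cd_sqnorm_continuous.
exact: sqrt_continuous.
Qed.

Theorem corollary4p13 (R : realType) (kind : hypercomplex_kind)
    (a b : R) (hab : a <= b)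
    (gamma : R -> hypercomplex R kind)
    (gamma_path : is_path a b gamma)
    (gamma_neq0 : forall t, t \in `[a, b] -> gamma t != 0)
    (frakI : R -> antipodal_sphere (hypercomplex R kind))
    (frakI_companion : is_companion a b gamma frakI)
    (k : int)
    (calI : R -> imaginary_units (hypercomplex R kind))
    (arg : R -> R)
    (Gamma : R -> hypercomplex R kind * hypercomplex R kind)
    (Gamma_lift : is_companion_lift a b gamma frakI k calI arg Gamma)
    (arg_a : 2 * k%:~R * pi <= arg_branch k arg a <= (2 * k%:~R + 1) * pi) :
  [/\ forall t, t \in `[a, b] ->
        log_chart (Gamma t) = of_real (hypercomplex R kind) (ln (modulus (gamma t))) + (Gamma t).2,
      is_log_continuation a b gamma (fun t => log_chart (Gamma t)) &
      log_chart (Gamma a) = of_real (hypercomplex R kind) (ln (modulus (gamma a))) + (Gamma a).2].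
Proof.
have L := cd_laws_hypercomplex R kind.
have [_ _ _ [Gamma_path Gamma_log] GammaE] := Gamma_lift.
have chartE t : t \in `[a, b] -> log_chart (Gamma t) =
    of_real (hypercomplex R kind) (ln (modulus (gamma t))) + (Gamma t).2.
  by move=> tab; rewrite GammaE.
have polar t : t \in `[a, b] -> exists r, [/\ 0 < r,
    imaginary _ (Gamma t).2 & Gamma t = (r *: hexp (Gamma t).2, (Gamma t).2)].
  by move=> /Gamma_log[[r [p [r0 imp ->]]] _]; exists r.
have unitI t : imaginary_units _ (set_val (calI t)).
  exact: set_valP.
split => //; last by apply: chartE; rewrite in_itv /= lexx hab.
split.
  (* The chart is continuous at [Gamma t] because the modulus there is [r > 0], where [ln] is
     continuous. *)
  apply/subspace_continuousP => t /= tab; have [r [r0 imG GE]] := polar t tab.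
  move/subspace_continuousP: Gamma_path => /(_ t tab) Gt.
  apply: (cvg_comp _ _ Gt); apply: (log_chart_continuous L).
  rewrite GE /=; move: imG; rewrite GammaE//= => imG.
  by rewrite modulus_complex_line_polar// ltW.
move=> t tab; have [r [r0 imG GE]] := polar t tab.
have [_ <-] := Gamma_log t tab.
(* [GammaE] exhibits the second component as a real multiple of the unit [calI t], placing the point
   on one complex line. *)
rewrite GE; move: imG; rewrite GammaE//= => imG.
by rewrite hexp_log_chart.
Qed.
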